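(* Let $n \ge 1$ and let $H \in \mathbb{C}^{2n \times 2n}$ be a normal Hamiltonian matrix. Then there exist a unitary and symplectic matrix $Z \in \mathbb{C}^{2n\times 2n}$, nonnegative integers $n_1, n_2$ with $n_1 + n_2 = n$, and diagonal matrices $D_1 \in \mathbb{C}^{n_1 \times n_1}$, $D_2 \in \imath\mathbb{R}^{n_2 \times n_2}$, $D_3 \in \mathbb{R}^{n_2 \times n_2}$ such that $$Z^H H Z = \begin{bmatrix} D_1 & 0 & 0 & 0\\ 0 & D_2 & 0 & D_3\\ 0 & 0 & -D_1^H & 0\\ 0 & -D_3 & 0 & D_2 \end{bmatrix},$$ this matrix is Hamiltonian, and $\begin{bmatrix} D_2 & D_3\\ -D_3 & D_2\end{bmatrix} \in \mathbb{C}^{2n_2\times 2n_2}$ is a Hamiltonian and skew-Hermitian matrix with purely imaginary eigenvalues.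
   Context: $X^H$ denotes the conjugate transpose of $X$, $I_m$ the $m\times m$ identity matrix, and $\imath$ the imaginary unit. For $m\ge 1$ put $J_{2m} = \begin{bmatrix} 0 & I_m\\ -I_m & 0\end{bmatrix} \in \mathbb{R}^{2m\times 2m}$. A matrix $H\in\mathbb{C}^{2m\times 2m}$ is called Hamiltonian if $(J_{2m}H)^H = J_{2m}H$. A matrix $S \in \mathbb{C}^{2m\times 2m}$ is called symplectic if $S^H J_{2m} S = J_{2m}$ (conjugate transpose, not transpose). A matrix $X$ is normal if $XX^H = X^HX$, unitary if $X^HX = XX^H = I$, and skew-Hermitian if $X^H=-X$. The rows and columns of the displayed $4\times 4$ block matrix are partitioned into sizes $n_1, n_2, n_1, n_2$; blocks of size zero (i.e. $n_1=0$ or $n_2=0$) are allowed and are then absent. ''Purely imaginary'' means real part equal to zero (the value $0$ is included). *)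

(* Defs.v *)
From mathcomp Require Import all_boot all_order all_algebra.
From mathcomp Require Import spectral.
Set Implicit Arguments.
Unset Strict Implicit.
Unset Printing Implicit Defensive.
Import GRing.Theory Num.Theory.
Local Open Scope ring_scope.
Local Open Scope sesquilinear_scope.

(* [M ^t*] is the conjugate transpose of [M]; on [R[i]] the conjugation is the
   usual complex one. *)

Section Structures.
Variable C : numClosedFieldType.

Definition Jmx (m : nat) : 'M[C]_(m + m) := block_mx 0 1%:M (- 1%:M) 0.

Definition hamiltonian m (H : 'M[C]_(m + m)) : Prop :=
  (Jmx m *m H)^t* = Jmx m *m H.

Definition symplectic m (S : 'M[C]_(m + m)) : Prop :=
  S^t* *m Jmx m *m S = Jmx m.

Definition skew_hermitian m (X : 'M[C]_m) : Prop := X^t* = - X.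

Definition purely_imaginary (z : C) : Prop := 'Re z = 0.

Definition imaginary_mx m n (X : 'M[C]_(m, n)) : Prop :=
  forall i j, purely_imaginary (X i j).

Definition rot_block m (D2 D3 : 'M[C]_m) : 'M[C]_(m + m) :=
  block_mx D2 D3 (- D3) D2.

Definition schur_block n1 n2 (D1 : 'M[C]_n1) (D2 D3 : 'M[C]_n2) :
    'M[C]_((n1 + n2) + (n1 + n2)) :=
  block_mx (block_mx D1 0 0 D2)         (block_mx 0 0 0 D3)
           (block_mx 0  0 0 (- D3))     (block_mx (- D1^t*) 0 0 D2).

End Structures.

(* Realizes the identification n1 + n2 = n on 2n x 2n matrices. *)
Definition castmx2 (T : Type) m n (e : m = n) (A : 'M[T]_(m + m)) :
    'M[T]_(n + n) :=
  let e2 := congr1 (fun k => (k + k)%N) e in castmx (e2, e2) A.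

(* Main.v *)
(* The unitary [U = Jeigen n] diagonalizes [J] as [diag (-i, i)], so that the
   Hamiltonian condition says that [U^* H U] has blocks [B1, G, G^*, B2] with
   [B1] and [B2] skew-Hermitian, and normality gives [B1 G = G B2].  This
   intertwining relation yields a singular value decomposition of [G] whose left
   and right singular vectors are eigenvectors of [B1] and [B2].  Unitaries of
   the form [U diag(V1, V2) U^*] commute with [J], so they are symplectic, and
   after such a change of basis [H] has diagonal blocks.  Where a singular value
   is nonzero, the eigenvalues of [B1] and [B2] agree and the entry belongs to
   [D1]; the remaining entries form [D2] and [D3]. *)

Require Import Defs.
From mathcomp Require Import all_boot all_order all_algebra all_fingroup ring.
From mathcomp Require Import spectral complex reals.
Set Implicit Arguments.
Unset Strict Implicit.
Unset Printing Implicit Defensive.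
Import Order.TTheory GRing.Theory Num.Theory.
Local Open Scope ring_scope.
Local Open Scope sesquilinear_scope.

Section Spectral.
Variable C : numClosedFieldType.

(** * Conjugate transposes and unitary matrices *)

Lemma trmxC_mul m n p (A : 'M[C]_(m, n)) (B : 'M_(n, p)) :
  (A *m B)^t* = B^t* *m A^t*.
Proof. by rewrite trmx_mul map_mxM. Qed.

Lemma trmxCN m n (A : 'M[C]_(m, n)) : (- A)^t* = - A^t*.
Proof. by apply/matrixP=> i j; rewrite !mxE rmorphN. Qed.

Lemma trmxCZ m n a (A : 'M[C]_(m, n)) : (a *: A)^t* = a^* *: A^t*.
Proof. by apply/matrixP=> i j; rewrite !mxE rmorphM. Qed.

Lemma trmxC0 m n : (0 : 'M[C]_(m, n))^t* = 0.
Proof. by apply/matrixP=> i j; rewrite !mxE rmorph0. Qed.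

Lemma trmxC_scalar n (a : C) : (a%:M : 'M_n)^t* = (a^*)%:M.
Proof. by rewrite tr_scalar_mx map_scalar_mx. Qed.

Lemma trmxC1 n : (1%:M : 'M[C]_n)^t* = 1%:M.
Proof. by rewrite trmxC_scalar rmorph1. Qed.

Lemma trmxC_diag n (d : 'rV[C]_n) : (diag_mx d)^t* = diag_mx (map_mx Num.conj d).
Proof. by rewrite tr_diag_mx map_diag_mx. Qed.

Lemma trmxC_col m1 m2 n (A : 'M[C]_(m1, n)) (B : 'M_(m2, n)) :
  (col_mx A B)^t* = row_mx (A^t*) (B^t*).
Proof. by rewrite tr_col_mx map_row_mx. Qed.

Lemma trmxC_block m1 m2 n1 n2 (A : 'M[C]_(m1, n1)) (B : 'M_(m1, n2))
    (D : 'M_(m2, n1)) (E : 'M_(m2, n2)) :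
  (block_mx A B D E)^t* = block_mx (A^t*) (D^t*) (B^t*) (E^t*).
Proof. by rewrite tr_block_mx map_block_mx. Qed.

Lemma unitarymxPl n (V : 'M[C]_n) : V \is unitarymx -> V^t* *m V = 1%:M.
Proof. by move=> uV; apply/mulmx1C/unitarymxP. Qed.

Lemma block_diag_unitary m n (V : 'M[C]_m) (W : 'M_n) :
  V \is unitarymx -> W \is unitarymx -> block_mx V 0 0 W \is unitarymx.
Proof.
move=> /unitarymxP uV /unitarymxP uW; apply/unitarymxP.
by rewrite trmxC_block !trmxC0 mulmx_block !mulmx0 !mul0mx uV uW !addr0 add0r
  -scalar_mx_block.
Qed.

(** * Unit eigenvectors and orthogonal complements *)

(** The factor is recorded as positive so that conjugation fixes it and its inverse can serve as a
    real singular value. *)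
Lemma normalize_row n (v : 'rV[C]_n) :
  v != 0 -> exists2 c : C, 0 < c & c *: v \is unitarymx.
Proof.
move=> v0; have vv := dotmx_is_dotmx v0.
exists (sqrtC (dotmx v v))^-1; first by rewrite invr_gt0 sqrtC_gt0.
apply/unitarymxP; rewrite trmxCZ -scalemxAl -scalemxAr scalerA.
rewrite [v *m _]mx11_scalar -dotmxE -mul_scalar_mx -scalar_mxM.
rewrite geC0_conj ?invr_ge0 ?sqrtC_ge0 ?ltW // -invfM -expr2 sqrtCK.
by rewrite mulVf // gt_eqF.
Qed.

(** Restricting [B] to the nonzero row space of [W] gives a matrix of positive size, which has an
    eigenvector over an algebraically closed field; [row_base W] carries it back. *)
Lemma stable_eigenvector m n (B : 'M[C]_n) (W : 'M_(m, n)) :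
    W != 0 -> stablemx W B ->
  exists (v : 'rV_n) (b : C), [/\ v \is unitarymx, (v <= W)%MS & v *m B = b *: v].
Proof.
move=> W0 sWB.
have [|b /eigenvalueP[u uB u0]] := @eigenvalue_closed C _ (restrictmx W B).
  by rewrite lt0n mxrank_eq0.
have v0 : u *m row_base W != 0 by rewrite mulmx_free_eq0 ?row_base_free.
have [c _ uc] := normalize_row v0.
exists (c *: (u *m row_base W)), b; split=> //.
  by rewrite scalemx_sub // mulmx_sub // eq_row_base.
rewrite -scalemxAl -mulmxA.
have -> : row_base W *m B = restrictmx W B *m row_base W.
  by rewrite mulmxKpV // stablemx_row_base.
by rewrite mulmxA uB -scalemxAl !scalerA mulrC.
Qed.

(** Gram-Schmidt on a basis of the kernel of [v^t*], the orthogonal complement of [v], which has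
    dimension [n]. *)
Lemma unitary_completion n (v : 'rV[C]_n.+1) :
  v \is unitarymx ->
  exists2 W : 'M_(n, n.+1), W \is unitarymx & v *m W^t* = 0.
Proof.
move=> uv; have rK : \rank (kermx (v^t*)) = n.
  by rewrite mxrank_ker mxrank_map mxrank_tr mxrank_unitary // subn1.
pose W := schmidt (row_base (kermx (v^t*))).
have uW : W \is unitarymx by rewrite schmidt_unitarymx // rank_leq_col.
have vW : v *m W^t* = 0.
  suff Wv : W *m v^t* = 0 by rewrite -[LHS]trmxCK trmxC_mul trmxCK Wv trmxC0.
  by apply/sub_kermxP; rewrite eqmx_schmidt_free ?row_base_free ?eq_row_base.
by move: W uW vW; rewrite rK => W; exists W.
Qed.

(** * Singular value decomposition of an intertwining matrix *)

(** Deflation step: these vectors split a 1 by 1 corner off [B1], [B2] and [G] at once. *)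
Lemma common_singular_pair n (B1 B2 G : 'M[C]_n.+1) :
    B1^t* = - B1 -> B2^t* = - B2 -> B1 *m G = G *m B2 ->
  exists (v1 v2 : 'rV_n.+1) (b1 b2 g : C),
    [/\ v1 \is unitarymx, v2 \is unitarymx & g \is Num.real] /\
    [/\ v1 *m B1 = b1 *: v1, v2 *m B2 = b2 *: v2,
        v1 *m G = g *: v2 & v2 *m G^t* = g *: v1].
Proof.
move=> sB1 sB2 BG.
(* The adjoint of [BG], where the two skewness signs cancel; hence [B2] commutes with
   [G^t* *m G]. *)
have BG' : B2 *m G^t* = G^t* *m B1.
  apply: oppr_inj; rewrite -mulNmx -mulmxN -sB1 -sB2.
  by rewrite -!trmxC_mul BG.
have [uG|sG] := boolP (G \in unitmx).
  (* A common eigenvector of [B2] and [G^* G] is a right singular vector. *)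
  have [//||v v0 /andP[/eigenvectorP[b /eigenspaceP vb]]] :=
    @common_eigenvector2 C _ B2 (G^t* *m G).
    by rewrite mulmxA BG' -!mulmxA BG.
  move=> /eigenvectorP[m /eigenspaceP vm].
  have [c _ uv] := normalize_row v0; set v2 := c *: v in uv.
  have v2b : v2 *m B2 = b *: v2 by rewrite -scalemxAl vb !scalerA mulrC.
  have v2m : v2 *m (G^t* *m G) = m *: v2.
    by rewrite -scalemxAl vm !scalerA mulrC.
  have u0 : v2 *m G^t* != 0.
    rewrite mulmx_free_eq0; last by rewrite row_free_unit map_unitmx unitmx_tr.
    by apply: contraTneq uv => ->; rewrite qualifE mul0mx eq_sym oner_eq0.
  have [d d0 ud] := normalize_row u0.
  (* Since [v2] is a unit eigenvector of [G^t* *m G], the unit length of the normalized row says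
     [d ^+ 2 * m = 1]; so [d^-1] is the singular value. *)
  have dm : d * m = d^-1.
    apply: (mulfI (lt0r_neq0 d0)); rewrite mulfV ?gt_eqF // mulrA.
    have /unitarymxP := ud; rewrite trmxCZ -scalemxAl -scalemxAr scalerA.
    rewrite trmxC_mul trmxCK mulmxA -(mulmxA v2) v2m -scalemxAl scalerA.
    rewrite (unitarymxP uv) geC0_conj ?ltW // => /matrixP/(_ 0 0).
    by rewrite !mxE mulr1.
  exists (d *: (v2 *m G^t*)), v2, b, b, d^-1; split; split=> //.
  - by rewrite realV ger0_real ?ltW.
  - by rewrite -scalemxAl -mulmxA -BG' mulmxA v2b -scalemxAl !scalerA mulrC.
  - by rewrite -scalemxAl -mulmxA v2m scalerA dm.
  - by rewrite scalerA mulVf ?scale1r ?gt_eqF.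
(* For singular [G], both kernels are nonzero and stable: pair two eigenvectors
   inside them with singular value 0. *)
have kerN0 (A : 'M[C]_n.+1) : A \notin unitmx -> kermx A != 0.
  by apply: contraNneq => /eqP; rewrite kermx_eq0 row_free_unit.
have [||v1 [b1 [u1 /sub_kermxP k1 e1]]] := @stable_eigenvector _ _ B1 (kermx G).
- exact: kerN0.
- by apply/sub_kermxP; rewrite -mulmxA BG mulmxA mulmx_ker mul0mx.
have [||v2 [b2 [u2 /sub_kermxP k2 e2]]] :=
  @stable_eigenvector _ _ B2 (kermx (G^t*)).
- by apply: kerN0; rewrite map_unitmx unitmx_tr.
- by apply/sub_kermxP; rewrite -mulmxA BG' mulmxA mulmx_ker mul0mx.
by exists v1, v2, b1, b2, 0; split; split; rewrite ?scale0r.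
Qed.

Lemma block_diag_diag n (a : C) (d : 'rV[C]_n) :
  block_mx a%:M 0 0 (diag_mx d) = diag_mx (row_mx a%:M d) :> 'M_(1 + n).
Proof.
rewrite diag_mx_row; congr (block_mx _ _ _ _).
by apply/matrixP=> i j; rewrite !ord1 !mxE eqxx.
Qed.

(** Induction on the size: [common_singular_pair] removes one dimension on each side, and the
    compressions to the orthogonal complements satisfy the same hypotheses. *)
Lemma simultaneous_svd n (B1 B2 G : 'M[C]_n) :
    B1^t* = - B1 -> B2^t* = - B2 -> B1 *m G = G *m B2 ->
  exists (V1 V2 : 'M_n) (d1 d2 g : 'rV_n),
    [/\ V1 \is unitarymx, V2 \is unitarymx & g \is a realmx] /\
    [/\ V1 *m B1 *m V1^t* = diag_mx d1, V2 *m B2 *m V2^t* = diag_mx d2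
      & V1 *m G *m V2^t* = diag_mx g].
Proof.
elim: n B1 B2 G => [|n IH] B1 B2 G sB1 sB2 BG.
  exists 1%:M, 1%:M, 0, 0, 0; split; split;
    try by [apply/matrixP=> -[] | apply/unitarymxP/matrixP=> -[]].
  by apply/mxOverP=> i [].
have [v1 [v2 [b1 [b2 [g [[u1 u2 rg] [e1 e2 eg eg']]]]]]] :=
  common_singular_pair sB1 sB2 BG.
have [W1 uW1 vW1] := unitary_completion u1.
have [W2 uW2 vW2] := unitary_completion u2.
have Wv W (v : 'rV[C]_n.+1) : v *m W^t* = 0 -> W *m v^t* = 0 :> 'M_(n, 1).
  by move=> h; rewrite -[W]trmxCK -trmxC_mul h trmxC0.
have uP W (v : 'rV[C]_n.+1) : v \is unitarymx -> W \is unitarymx ->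
    v *m W^t* = 0 -> (col_mx v W : 'M_(1 + n)) \is unitarymx.
  move=> /unitarymxP uv /unitarymxP uW h; apply/unitarymxP.
  by rewrite trmxC_col mul_col_row uv uW h Wv // -scalar_mx_block.
pose P1 : 'M_(1 + n) := col_mx v1 W1; pose P2 : 'M_(1 + n) := col_mx v2 W2.
have uP1 : P1 \is unitarymx by apply: uP.
have uP2 : P2 \is unitarymx by apply: uP.
(* By skewness, [v^t*] is also a column eigenvector of [B], so both off-diagonal blocks vanish. *)
have PB B W (v : 'rV[C]_n.+1) b : B^t* = - B -> v \is unitarymx ->
    v *m W^t* = 0 -> v *m B = b *: v ->
    (col_mx v W : 'M_(1 + n)) *m B *m (col_mx v W : 'M_(1 + n))^t* =
      block_mx b%:M 0 0 (W *m B *m W^t*).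
  move=> sB /unitarymxP uv h e; rewrite trmxC_col mul_col_mx mul_col_row.
  rewrite e -!scalemxAl uv h scaler0 scalemx1; congr (block_mx _ _ _ _).
  apply: oppr_inj; rewrite -mulNmx -mulmxN -sB oppr0 -mulmxA -trmxC_mul e.
  by rewrite trmxCZ -scalemxAr Wv // scaler0.
have PB1 := PB _ _ _ _ sB1 u1 vW1 e1; have PB2 := PB _ _ _ _ sB2 u2 vW2 e2.
rewrite -/P1 in PB1; rewrite -/P2 in PB2.
(* [eg] clears the upper right block and [eg'] the lower left one. *)
have PG : P1 *m G *m P2^t* = block_mx g%:M 0 0 (W1 *m G *m W2^t*).
  rewrite trmxC_col mul_col_mx mul_col_row eg -!scalemxAl.
  rewrite (unitarymxP u2) vW2 scaler0 scalemx1; congr (block_mx _ _ _ _).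
  rewrite -[G]trmxCK -mulmxA -trmxC_mul eg'.
  by rewrite trmxCZ -scalemxAr Wv // scaler0.
have [|||V1 [V2 [d1 [d2 [g' [[uV1 uV2 rg'] [E1 E2 E3]]]]]]] :=
  IH (W1 *m B1 *m W1^t*) (W2 *m B2 *m W2^t*) (W1 *m G *m W2^t*).
- by rewrite !trmxC_mul trmxCK sB1 mulNmx mulmxN mulmxA.
- by rewrite !trmxC_mul trmxCK sB2 mulNmx mulmxN mulmxA.
(* The intertwining relation for the compressions is the lower right block of [BG] in the new
   bases. *)
- have : (P1 *m B1 *m P1^t*) *m (P1 *m G *m P2^t*) =
         (P1 *m G *m P2^t*) *m (P2 *m B2 *m P2^t*).
    by rewrite !mulmxA !mulmxKtV // -(mulmxA P1) BG mulmxA.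
  rewrite PB1 PB2 PG !mulmx_block !(mulmx0, mul0mx, addr0, add0r).
  by case/eq_block_mx.
pose X (V : 'M[C]_n) : 'M_(1 + n) := block_mx 1%:M 0 0 V.
have XD V V' (D : 'M[C]_n) a d : V *m D *m V'^t* = diag_mx d ->
    X V *m block_mx a%:M 0 0 D *m (X V')^t* = diag_mx (row_mx a%:M d).
  move=> e; rewrite -block_diag_diag -e trmxC_block !mulmx_block !trmxC0 trmxC1.
  by rewrite !(mulmx0, mul0mx, addr0, add0r, mulmx1, mul1mx).
have uX V : V \is unitarymx -> X V \is unitarymx.
  by apply: block_diag_unitary; apply/unitarymxP; rewrite trmxC1 mulmx1.
exists (X V1 *m P1), (X V2 *m P2), (row_mx b1%:M d1), (row_mx b2%:M d2),
  (row_mx g%:M g'); split; split.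
- by rewrite mul_unitarymx // uX.
- by rewrite mul_unitarymx // uX.
- apply/mxOverP=> i j; rewrite !mxE; case: splitP => k _; last exact/mxOverP.
  by rewrite !mxE !ord1.
- by rewrite trmxC_mul !mulmxA -2!(mulmxA (X V1)) PB1 (XD _ _ _ _ _ E1).
- by rewrite trmxC_mul !mulmxA -2!(mulmxA (X V2)) PB2 (XD _ _ _ _ _ E2).
- by rewrite trmxC_mul !mulmxA -2!(mulmxA (X V1)) PG (XD _ _ _ _ _ E3).
Qed.

(** * Sorting the diagonal entries by a permutation *)

(** The permutation lists the indices satisfying [p] first and the others after them; [n1] and [n2]
    count the two groups. *)
Lemma perm_prefix n (p : pred 'I_n) :
  exists (n1 n2 : nat) (_ : (n1 + n2)%N = n) (s : 'S_n),
    forall i, p (s i) = (i < n1)%N.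
Proof.
pose r := enum 'I_n; pose t := filter p r ++ filter (predC p) r.
have rt : perm_eq t r by apply/permPl/perm_filterC.
have szt : size t == n by rewrite (perm_size rt) size_enum_ord.
have /tuple_permP[s es] : perm_eq (Tuple szt) (ord_tuple n) by rewrite val_ord_tuple.
exists (size (filter p r)), (size (filter (predC p) r)).
have e : (size (filter p r) + size (filter (predC p) r))%N = n.
  by rewrite -size_cat; apply/eqP.
exists e, s => i.
have -> : s i = nth i t i.
  have -> : t = [tuple tnth (ord_tuple n) (s j) | j < n] := es.
  by rewrite -tnth_nth tnth_mktuple tnth_ord_tuple.
rewrite /t nth_cat; case: ltnP => h.
  by have := mem_nth i h; rewrite mem_filter => /andP[].
have : (i - size (filter p r) < size (filter (predC p) r))%N.
  by rewrite ltn_subLR // e.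
by move=> /(mem_nth i); rewrite mem_filter => /andP[/negbTE].
Qed.

Lemma perm_mx_unitary n (s : 'S_n) : (perm_mx s : 'M[C]_n) \is unitarymx.
Proof.
apply/unitarymxP.
by rewrite tr_perm_mx map_perm_mx -perm_mxM mulgV perm_mx1.
Qed.

Lemma perm_conj_diag n (s : 'S_n) (d : 'rV[C]_n) :
  perm_mx s *m diag_mx d *m (perm_mx s)^t* = diag_mx (col_perm s d).
Proof.
rewrite tr_perm_mx map_perm_mx -row_permE -col_permE.
by apply/matrixP=> i j; rewrite !mxE (inj_eq perm_inj).
Qed.

(** Permuting both bases by the same [s] keeps all three matrices diagonal and moves the nonzero
    entries of [g] to the front. *)
Lemma simultaneous_svd_sorted n (B1 B2 G : 'M[C]_n) :
    B1^t* = - B1 -> B2^t* = - B2 -> B1 *m G = G *m B2 ->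
  exists (n1 n2 : nat) (_ : (n1 + n2)%N = n)
         (V1 V2 : 'M_n) (d1 d2 g : 'rV_n),
    [/\ V1 \is unitarymx, V2 \is unitarymx, g \is a realmx
      & forall i, (g 0 i != 0) = (i < n1)%N] /\
    [/\ V1 *m B1 *m V1^t* = diag_mx d1, V2 *m B2 *m V2^t* = diag_mx d2
      & V1 *m G *m V2^t* = diag_mx g].
Proof.
move=> sB1 sB2 BG.
have [V1 [V2 [d1 [d2 [g [[u1 u2 rg] [e1 e2 eg]]]]]]] :=
  simultaneous_svd sB1 sB2 BG.
have [n1 [n2 [e [s sP]]]] := perm_prefix (fun i => g 0 i != 0).
exists n1, n2, e, (perm_mx s *m V1), (perm_mx s *m V2), (col_perm s d1),
  (col_perm s d2), (col_perm s g).
split; split; try by rewrite mul_unitarymx // perm_mx_unitary.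
- by apply/mxOverP=> i j; rewrite mxE; apply/mxOverP.
- by move=> i; rewrite mxE sP.
- by rewrite -perm_conj_diag -e1 trmxC_mul !mulmxA.
- by rewrite -perm_conj_diag -e2 trmxC_mul !mulmxA.
- by rewrite -perm_conj_diag -eg trmxC_mul !mulmxA.
Qed.

(** * Hamiltonian blocks and skew-Hermitian spectra *)

Lemma hamiltonian_block n (A B D E : 'M[C]_n) :
  B^t* = B -> D^t* = D -> E = - A^t* -> hamiltonian (block_mx A B D E).
Proof.
move=> hB hD ->; rewrite /hamiltonian /Jmx mulmx_block !mul0mx !mul1mx !mulNmx.
by rewrite !mul1mx !addr0 !add0r trmxC_block !trmxCN trmxCK hB hD.
Qed.

Lemma purely_imaginaryP (z : C) : z^* = - z -> purely_imaginary z.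
Proof. by move=> e; rewrite /purely_imaginary ReE e subrr mul0r. Qed.

(** For a unit eigenvector [u], [a] is the Rayleigh quotient [u *m X *m u^t*], which changes sign
    under the adjoint as [X] does. *)
Lemma skew_eigenvalue n (X : 'M[C]_n) a :
  X^t* = - X -> eigenvalue X a -> purely_imaginary a.
Proof.
move=> sX /eigenvalueP[v vX v0]; apply: purely_imaginaryP.
have [c _ /unitarymxP uu] := normalize_row v0.
move: uu; set u := c *: v => uu.
have uX : u *m X = a *: u by rewrite -scalemxAl vX !scalerA mulrC.
have ea : u *m X *m u^t* = a%:M by rewrite uX -scalemxAl uu scalemx1.
have : (u *m X *m u^t*)^t* = - (u *m X *m u^t*).
  by rewrite !trmxC_mul trmxCK sX mulNmx mulmxN mulmxA.
by rewrite ea trmxC_scalar => /matrixP/(_ 0 0); rewrite !mxE !mulr1n.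
Qed.

(** * Diagonalization of [Jmx] *)

Definition Jeigen n : 'M[C]_(n + n) :=
  (sqrtC 2)^-1 *: block_mx 1%:M 1%:M (- 'i)%:M 'i%:M.

Definition Jspec n : 'M[C]_(n + n) := block_mx (- 'i)%:M 0 0 'i%:M.

(** Arbitrary blocks are allowed because the formula is applied to the identity (unitarity of
    [Jeigen]), to [Jspec], and to the diagonalized blocks of [H]. *)
Lemma Jeigen_conj n (A B D E : 'M[C]_n) :
  Jeigen n *m block_mx A B D E *m (Jeigen n)^t* =
    2^-1 *: block_mx (A + B + D + E) ('i *: (A + D - B - E))
                     ('i *: (D + E - A - B)) (A + E - B - D).
Proof.
have conjNi : (- 'i : C)^* = 'i by rewrite rmorphN /= conjCi opprK.
rewrite /Jeigen trmxCZ trmxC_block !trmxC_scalar conjC1 conjNi conjCi.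
rewrite -!scalemxAl -scalemxAr scalerA geC0_conj ?invr_ge0 ?sqrtC_ge0 //.
rewrite -invfM -expr2 sqrtCK !mulmx_block !mul1mx !mulmx1 !mul_scalar_mx.
rewrite !mul_mx_scalar.
congr (_ *: block_mx _ _ _ _); apply/matrixP=> i j; rewrite !mxE; try ring.
(* Only the lower right block multiplies two factors ['i], so only there is ['i ^+ 2 = -1] needed
   besides [ring]. *)
transitivity (- 'i ^+ 2 * (A i j + E i j - B i j - D i j)); first by ring.
by rewrite sqrCi opprK mul1r.
Qed.

Lemma Jeigen_unitary n : Jeigen n \is unitarymx.
Proof.
apply/unitarymxP; rewrite -{1}[Jeigen n]mulmx1 scalar_mx_block Jeigen_conj.
rewrite !addr0 !subr0 !subrr !add0r !scaler0 scale_block_mx.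
rewrite subrr !scaler0 -mulr2n -scaler_nat scalerA mulVf ?scale1r ?pnatr_eq0 //.
Qed.

Lemma Jmx_spectral n : Jmx C n = Jeigen n *m Jspec n *m (Jeigen n)^t*.
Proof.
have ii : 'i * 'i = -1 :> C by rewrite -expr2 sqrCi.
have two_neq0 : 2 != 0 :> C by rewrite pnatr_eq0.
rewrite Jeigen_conj !addr0 !subr0 add0r scale_block_mx.
congr (block_mx _ _ _ _); apply/matrixP=> i j; rewrite !mxE;
  case: (i == j); rewrite ?mulr1n ?mulr0n ?oppr0 ?addr0 ?mulr0 //.
all: try by rewrite addNr mulr0.
- by rewrite -opprD mulrN mulrDr ii; field.
- by rewrite opprK mulrDr ii; field.
Qed.

(** Conjugating the imaginary scalars of [Jspec] produces a sign on the diagonal blocks; off the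
    diagonal the opposite scalars of the two block rows absorb it. *)
Lemma Jspec_hamiltonian n (A B D E : 'M[C]_n) :
  (Jspec n *m block_mx A B D E)^t* = Jspec n *m block_mx A B D E ->
  [/\ A^t* = - A, D = B^t* & E^t* = - E].
Proof.
rewrite /Jspec mulmx_block !mul0mx !addr0 !add0r !mul_scalar_mx trmxC_block.
rewrite !trmxCZ rmorphN /= conjCi opprK !scaleNr.
have iI : injective ( *:%R 'i : 'M[C]_n -> 'M[C]_n).
  by apply: scalerI; rewrite neq0Ci.
case/eq_block_mx; rewrite -!scalerN => /iI eA _ /iI eB /iI eE; split=> //.
by rewrite -[E^t*]opprK -[in RHS]eE.
Qed.

(** * Reduction of [H] to diagonal blocks *)

Lemma hamiltonian_svd n (H : 'M[C]_(n + n)) :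
    H \is normalmx -> hamiltonian H ->
  exists (n1 n2 : nat) (_ : (n1 + n2)%N = n)
         (Z : 'M_(n + n)) (d1 d2 g : 'rV_n),
    [/\ Z \is unitarymx, symplectic Z
      & Z^t* *m H *m Z = Jeigen n
          *m block_mx (diag_mx d1) (diag_mx g) (diag_mx g) (diag_mx d2)
          *m (Jeigen n)^t*] /\
    [/\ map_mx Num.conj d1 = - d1, map_mx Num.conj d2 = - d2, g \is a realmx,
        forall i, (g 0 i != 0) = (i < n1)%N
      & forall i, g 0 i != 0 -> d1 0 i = d2 0 i].
Proof.
move=> /normalmxP nH hH; set U := Jeigen n.
have uU : U \is unitarymx := Jeigen_unitary n.
pose M := U^t* *m H *m U.
have nM : M *m M^t* = M^t* *m M.
  rewrite /M !trmxC_mul trmxCK !mulmxA !(mulmxtVK _ uU).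
  by congr (_ *m _); rewrite -!mulmxA nH.
have hM : (Jspec n *m M)^t* = Jspec n *m M.
  have -> : Jspec n *m M = U^t* *m (Jmx C n *m H) *m U.
    by rewrite Jmx_spectral /M !mulmxA (unitarymxPl uU) mul1mx.
  by rewrite trmxC_mul (trmxC_mul (U^t*)) hH trmxCK !mulmxA.
move: nM hM (esym (submxK M)).
set B1 := ulsubmx M; set G := ursubmx M; set B2 := drsubmx M => nM hM eM.
move: nM; rewrite eM in hM *; have [sB1 eG sB2] := Jspec_hamiltonian hM.
rewrite eG in eM *.
rewrite trmxC_block !mulmx_block trmxCK sB1 sB2 => /eq_block_mx[_ + _ _].
rewrite !mulmxN !mulNmx => nM.
(* The off-diagonal block of normality only says that [B1 *m G - G *m B2] equals its own negative,
   hence the cancellation of 2. *)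
have BG : B1 *m G = G *m B2.
  have two_neq0 : 2 != 0 :> C by rewrite pnatr_eq0.
  apply/(scalerI two_neq0)/eqP; rewrite -subr_eq0 -scalerBr scaler_nat mulr2n.
  by rewrite {1}nM addrACA addNr addrN addr0.
have [n1 [n2 [e [V1 [V2 [d1 [d2 [g [[u1 u2 rg pg] [e1 e2 eg]]]]]]]]]] :=
  simultaneous_svd_sorted sB1 sB2 BG.
pose W := block_mx V1 0 0 V2.
have uW : W \is unitarymx by apply: block_diag_unitary.
have WS : W *m Jspec n = Jspec n *m W.
  rewrite !mulmx_block !(mulmx0, mul0mx, addr0, add0r).
  by rewrite !mul_scalar_mx !mul_mx_scalar.
have tg : (diag_mx g)^t* = diag_mx g by rewrite trmxC_diag realmxC.
have eg' : V2 *m G^t* *m V1^t* = diag_mx g.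
  by rewrite -tg -eg !trmxC_mul trmxCK !mulmxA.
have skew_d (B V : 'M[C]_n) (d : 'rV[C]_n) : B^t* = - B -> V *m B *m V^t* = diag_mx d ->
    map_mx Num.conj d = - d.
  move=> sB eV; have : (diag_mx d)^t* = - diag_mx d.
    by rewrite -eV !trmxC_mul trmxCK sB mulNmx mulmxN mulmxA.
  rewrite trmxC_diag => /matrixP ed; apply/rowP=> i.
  by have := ed i i; rewrite !mxE eqxx !mulr1n.
exists n1, n2, e, (U *m W^t* *m U^t*), d1, d2, g; split; split=> //.
- by rewrite !mul_unitarymx // trmxC_unitary.
- rewrite /symplectic !trmxC_mul !trmxCK Jmx_spectral -/U !mulmxA !mulmxKtV //.
  by rewrite -(mulmxA U W) WS mulmxA mulmxtVK.
- rewrite !trmxC_mul !trmxCK.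
  transitivity (U *m (W *m M *m W^t*) *m U^t*); first by rewrite /M !mulmxA.
  congr (_ *m _ *m _); rewrite eM /W trmxC_block !trmxC0 !mulmx_block.
  rewrite !(mulmx0, mul0mx, addr0, add0r).
  by rewrite e1 e2 eg eg'.
- exact: skew_d sB1 e1.
- exact: skew_d sB2 e2.
(* The intertwining relation, read on the diagonal, lets a nonzero [g 0 i] be cancelled. *)
have : diag_mx d1 *m diag_mx g = diag_mx g *m diag_mx d2.
  by rewrite -e1 -e2 -eg !mulmxA !mulmxKtV // -(mulmxA V1) BG !mulmxA.
rewrite !mulmx_diag => /matrixP ed i gi; have := ed i i.
by rewrite !mxE eqxx !mulr1n mulrC => /(mulfI gi).
Qed.

Lemma normal_hamiltonian_schur n (H : 'M[C]_(n + n)) :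
  H \is normalmx -> hamiltonian H ->
  exists (Z : 'M[C]_(n + n)) (n1 n2 : nat) (e : (n1 + n2)%N = n)
         (D1 : 'M[C]_n1) (D2 D3 : 'M[C]_n2),
    (Z \is unitarymx /\ symplectic Z) /\
    [/\ is_diag_mx D1, is_diag_mx D2 & is_diag_mx D3] /\
    (imaginary_mx D2 /\ D3 \is a realmx) /\
    Z^t* *m H *m Z = castmx2 e (schur_block D1 D2 D3) /\
    hamiltonian (schur_block D1 D2 D3) /\
    [/\ hamiltonian (rot_block D2 D3), skew_hermitian (rot_block D2 D3)
      & forall a : C, eigenvalue (rot_block D2 D3) a -> purely_imaginary a].
Proof.
move=> nH hH; have [n1 [n2 [e]]] := hamiltonian_svd nH hH.
(* Substitution turns the size equation into [erefl], so [castmx2] becomes the identity. *)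
subst n => -[Z [d1 [d2 [g [[uZ sZ ZHZ] [id1 id2 rg pg gd]]]]]].
(* [E] and [D] are what [Jeigen_conj] makes of [d1] and [d2]: the first is imaginary, the second
   real. *)
pose E := 2^-1 *: (d1 + d2); pose D := 2^-1 *: ('i *: (d1 - d2)).
have iE : map_mx Num.conj E = - E.
  rewrite /E map_mxZ map_mxD id1 id2 -opprD scalerN.
  by rewrite /= fmorphV /= conjC_nat.
have rD : map_mx Num.conj D = D.
  rewrite /D !map_mxZ map_mxB id1 id2 -opprB opprK addrC.
  rewrite /= fmorphV /= conjC_nat conjCi; congr (_ *: _).
  by rewrite -opprB scalerN scaleNr opprK.
have ZHZE : Z^t* *m H *m Z =
    block_mx (diag_mx (E + g)) (diag_mx D) (- diag_mx D) (diag_mx (E - g)).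
  rewrite ZHZ Jeigen_conj scale_block_mx.
  have two_neq0 : 2 != 0 :> C by rewrite pnatr_eq0.
  congr (block_mx _ _ _ _); apply/matrixP=> i j; rewrite !mxE;
    case: (i == j); rewrite ?mulr1n ?mulr0n; by field.
(* On the first [n1] indices [d1] and [d2] agree, which kills [D]; on the others [g] vanishes, which
   leaves [E] in both diagonal blocks. *)
have D0 (i : 'I_(n1 + n2)) : (i < n1)%N -> D 0 i = 0.
  by rewrite -pg => /gd e; rewrite !mxE e subrr !mulr0.
have g0 (i : 'I_(n1 + n2)) : (n1 <= i)%N -> g 0 i = 0.
  by rewrite leqNgt -pg negbK => /eqP.
pose D1 := diag_mx (lsubmx (E + g)).
pose D2 := diag_mx (rsubmx E); pose D3 := diag_mx (rsubmx D).
have tD2 : D2^t* = - D2.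
  by rewrite trmxC_diag map_rsubmx iE !raddfN.
have tD3 : D3^t* = D3 by rewrite trmxC_diag map_rsubmx rD.
have skew : skew_hermitian (rot_block D2 D3).
  by rewrite /skew_hermitian trmxC_block opp_block_mx trmxCN tD2 tD3 opprK.
exists Z, n1, n2, erefl, D1, D2, D3; split=> //; split.
  by rewrite !diag_mx_is_diag.
split.
  split=> [i j|].
    apply: purely_imaginaryP.
    have /rowP/(_ (rshift n1 i)) := iE; rewrite !mxE.
    by case: (i == j); rewrite ?mulr1n // !mulr0n rmorph0 oppr0.
  apply/mxOverP=> i j; rewrite CrealE mxE.
  have /rowP/(_ (rshift n1 i)) := rD; rewrite !mxE.
  by case: (i == j); rewrite ?mulr1n ?mulr0n ?rmorph0 // => ->.
split.
  rewrite ZHZE /castmx2 castmx_id /schur_block.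
  rewrite -[E + g]hsubmxK -[E - g]hsubmxK -[D]hsubmxK !diag_mx_row.
  have -> : lsubmx D = 0 by apply/rowP=> i; rewrite mxE D0 ?mxE /=.
  have -> : rsubmx (E + g) = rsubmx E.
    by apply/rowP=> i; rewrite !mxE g0 ?addr0 //= leq_addr.
  have -> : rsubmx (E - g) = rsubmx E.
    by apply/rowP=> i; rewrite !mxE g0 ?subr0 //= leq_addr.
  (* As [E] is imaginary and [g] real, minus the conjugate of [E + g] is [E - g]. *)
  have -> : diag_mx (lsubmx (E - g)) = - D1^t*.
    rewrite trmxC_diag map_lsubmx map_mxD iE realmxC //.
    by apply/matrixP=> i j; rewrite !mxE; case: (i == j); ring.
  by rewrite opp_block_mx !raddf0.
split; last first.
  split=> //; last by move=> a; apply: skew_eigenvalue.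
  by apply: hamiltonian_block; rewrite ?trmxCN ?tD3 // tD2 opprK.
apply: hamiltonian_block.
- by rewrite trmxC_block !trmxC0 tD3.
- by rewrite trmxC_block !trmxC0 trmxCN tD3.
- by rewrite trmxC_block opp_block_mx !trmxC0 !oppr0 tD2 opprK.
Qed.
End Spectral.

Theorem theorem2p2 (R : realType) (n : nat) (H : 'M[R[i]]_(n + n)) :
  (0 < n)%N -> H \is normalmx -> hamiltonian H ->
  exists (Z : 'M[R[i]]_(n + n)) (n1 n2 : nat) (e : (n1 + n2)%N = n)
         (D1 : 'M[R[i]]_n1) (D2 D3 : 'M[R[i]]_n2),
    (Z \is unitarymx /\ symplectic Z) /\
    [/\ is_diag_mx D1, is_diag_mx D2 & is_diag_mx D3] /\
    (imaginary_mx D2 /\ D3 \is a realmx) /\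
    Z^t* *m H *m Z = castmx2 e (schur_block D1 D2 D3) /\
    hamiltonian (schur_block D1 D2 D3) /\
    [/\ hamiltonian (rot_block D2 D3), skew_hermitian (rot_block D2 D3)
      & forall a : R[i], eigenvalue (rot_block D2 D3) a -> purely_imaginary a].
Proof. by move=> _; apply: normal_hamiltonian_schur. Qed.
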